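(* Any finite weighted graph $(G,\mu,\sigma)$ with vertex measure $\mu$ and signature $\sigma:E^{or}\to H$, where $H=O(d)$ or $U(d)$, satisfies the inequality $$CD^\sigma\left(\frac{2}{D_G^{nor}}-D_G^{non},\,2\right).$$ In particular, any unweighted cycle graph (i.e. $w\equiv1$) with constant vertex measure $\mu\equiv\nu_0>0$ and any signature $\sigma:E^{or}\to H$ satisfies $CD^\sigma(0,2)$.
   Context: $G=(V,E,w)$ is a finite undirected simple graph with edge weights $w_{xy}=w_{yx}>0$ for $\{x,y\}\in E$; $x\sim y$ means $\{x,y\}\in E$; $d_x=\sum_{y\sim x}w_{xy}$; $\mu:V\to(0,\infty)$; $E^{or}=\{(x,y),(y,x)\mid\{x,y\}\in E\}$. $D_G^{non}=\max_{x\in V}\frac{d_x}{\mu(x)}$ and $D_G^{nor}=\max_{x\in V}\max_{y\sim x}\frac{\mu(x)}{w_{xy}}$ ($E\neq\emptyset$). $\mathbb{K}=\mathbb{R}$ if $H=O(d)$, $\mathbb{K}=\mathbb{C}$ if $H=U(d)$. A signature is a map $\sigma:E^{or}\to H$ with $\sigma_{yx}=\sigma_{xy}^{-1}$. For $u:V\to\mathbb{K}$, $\Delta u(x)=\frac1{\mu(x)}\sum_{y\sim x}w_{xy}(u(y)-u(x))$; for $f:V\to\mathbb{K}^d$, $\Delta^\sigma f(x)=\frac1{\mu(x)}\sum_{y\sim x}w_{xy}(\sigma_{xy}f(y)-f(x))$. Define $2\Gamma^\sigma(f,g)=\Delta(f^T\overline g)-f^T(\overline{\Delta^\sigma g})-(\Delta^\sigma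 f)^T\overline g$ and $2\Gamma_2^\sigma(f,g)=\Delta\Gamma^\sigma(f,g)-\Gamma^\sigma(f,\Delta^\sigma g)-\Gamma^\sigma(\Delta^\sigma f,g)$. $CD^\sigma(K,n)$ means $\Gamma_2^\sigma(f,f)(x)\ge\frac1n|\Delta^\sigma f(x)|^2+K\,\Gamma^\sigma(f,f)(x)$ for all $f:V\to\mathbb{K}^d$, $x\in V$. *)

(* Defs.v *)
From HB Require Import structures.
From mathcomp Require Import all_boot all_order all_algebra.
From mathcomp Require Import reals.
From mathcomp.real_closed Require Import complex.

Set Implicit Arguments.
Unset Strict Implicit.
Unset Printing Implicit Defensive.

Import Order.TTheory GRing.Theory Num.Theory.
Local Open Scope ring_scope.

Record wgraph (R : realType) := WGraph {
  vert :> finType;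
  adj : rel vert;
  wt : vert -> vert -> R; (* only meaningful on adjacent pairs *)
  adj_sym : symmetric adj;
  adj_irr : irreflexive adj;
  wt_sym : forall x y, adj x y -> wt x y = wt y x;
  wt_gt0 : forall x y, adj x y -> 0 < wt x y
}.

Definition wdeg (R : realType) (G : wgraph R) (x : G) : R :=
  \sum_(y | adj x y) wt x y.

(* The elements of these two maxima are nonnegative, so the default value 0
   does not change the maximum as soon as the index set is nonempty: a vertex
   for [Dnon], an edge for [Dnor]. *)
Definition Dnon (R : realType) (G : wgraph R) (mu : G -> R) : R :=
  \big[Num.max/0]_(x : G) (wdeg x / mu x).

Definition Dnor (R : realType) (G : wgraph R) (mu : G -> R) : R :=
  \big[Num.max/0]_(x : G) \big[Num.max/0]_(y : G | adj x y) (mu x / wt x y).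

Definition unweighted (R : realType) (G : wgraph R) : Prop :=
  forall x y : G, adj x y -> wt x y = 1.

(* The vertices can be listed without repetition as x_0, ..., x_(n-1), n >= 3,
   so that the edges are exactly the {x_i, x_(i+1 mod n)}. *)
Definition cycle_graph (R : realType) (G : wgraph R) : Prop :=
  exists s : seq G,
    [/\ uniq s, (forall x : G, x \in s), (2 < size s)%N &
        forall x y : G, adj x y = (y == next s x) || (x == next s y)].

(* The group H is O(d) or U(d); it determines the field K (R or C). *)
Inductive matrix_group := Orthogonal | Unitary.

Definition scalars (R : realType) (H : matrix_group) : numFieldType :=
  match H with Orthogonal => R | Unitary => R[i] end.

Definition ofreal (R : realType) (H : matrix_group) : R -> scalars R H :=
  match H return R -> scalars R H with
  | Orthogonal => fun a => a
  | Unitary => fun a => a%:C%C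
  end.

Definition conjs (R : realType) (H : matrix_group) : scalars R H -> scalars R H :=
  match H return scalars R H -> scalars R H with
  | Orthogonal => fun a => a
  | Unitary => fun a : R[i] => a^*
  end.

Definition in_group (R : realType) (H : matrix_group) (d : nat) :
    'M[scalars R H]_d -> Prop :=
  match H return 'M[scalars R H]_d -> Prop with
  | Orthogonal => fun A => A *m A^T = 1%:M
  | Unitary => fun A : 'M[R[i]]_d => A \is unitarymx
  end.

(* A map on oriented edges, encoded as a function on all pairs of vertices
   that is constrained, and used, on adjacent pairs only. *)
Definition signature (R : realType) (H : matrix_group) (d : nat)
    (G : wgraph R) (sigma : G -> G -> 'M[scalars R H]_d) : Prop :=
  forall x y : G, adj x y ->
    in_group (sigma x y) /\ sigma y x = invmx (sigma x y).

Section Operators.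
Variables (R : realType) (H : matrix_group) (d : nat).
Variables (G : wgraph R) (mu : G -> R).
Variable sigma : G -> G -> 'M[scalars R H]_d.

Local Notation K := (scalars R H).
Local Notation "a %:K" := (ofreal H a) (at level 2, format "a %:K").

Definition lap (u : G -> K) (x : G) : K :=
  ((mu x)^-1)%:K * \sum_(y | adj x y) (wt x y)%:K * (u y - u x).

Definition slap (f : G -> 'cV[K]_d) (x : G) : 'cV[K]_d :=
  ((mu x)^-1)%:K *: \sum_(y | adj x y) (wt x y)%:K *: (sigma x y *m f y - f x).

(* f^T \bar g, as a function on the vertices. *)
Definition hprod (f g : G -> 'cV[K]_d) (x : G) : K :=
  ((f x)^T *m map_mx (@conjs R H) (g x)) 0 0.

Definition sqnorm (v : 'cV[K]_d) : K := \sum_(i < d) `|v i 0| ^+ 2.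

Definition Gam (f g : G -> 'cV[K]_d) (x : G) : K :=
  2^-1 * (lap (hprod f g) x - hprod f (slap g) x - hprod (slap f) g x).

Definition Gam2 (f g : G -> 'cV[K]_d) (x : G) : K :=
  2^-1 * (lap (Gam f g) x - Gam f (slap g) x - Gam (slap f) g x).

(* All three terms are real. In R[i], a <= b means that b - a is a nonnegative
   real, so that for K = R[i] this is the inequality between real numbers. *)
Definition CD (k n : R) : Prop :=
  forall (f : G -> 'cV[K]_d) (x : G),
    (1 / n)%:K * sqnorm (slap f x) + k%:K * Gam f f x <= Gam2 f f x.

End Operators.

(* Main.v *)
Require Import Defs.
From HB Require Import structures.
From mathcomp Require Import all_boot all_order all_algebra.
From mathcomp Require Import reals.
From mathcomp Require Import ring lra.
From mathcomp.real_closed Require Import complex.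
(**
The proof is a Bochner-type computation.  Write [v_xy = sigma_xy f(y) - f(x)]
for the derivative of [f] along the oriented edge [xy] ([edge_diff]) and
[L] for the connection Laplacian of [f].  Unitarity of the signature gives
[Gamma(f,g)(x) = 1/(2 mu_x) sum_y w_xy <v_xy(f), v_xy(g)>] ([GamE]), whence
[[
  2 Gamma_2(f,f)(x) = |L(x)|^2
    + 1/mu_x sum_y w_xy (T_xy - Gamma(f,f)(x)),
  T_xy = Gamma(f,f)(y) - Re <v_xy, sigma_xy L(y)>.
]]
The term [|L(x)|^2] is where the dimension 2 comes from ([Gam2E]).

Completing the square turns [T_xy] into
[1/(2 mu_y) sum_z w_yz (|sigma_xy v_yz - v_xy|^2 - |v_xy|^2)]
([transport_defectE]).  The only squares that are controlled in general are
those of the backtracking walks [z = x]: there [sigma_xy v_yx = - v_xy]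
([edge_diff_back]), so the square equals [4 |v_xy|^2].  Discarding all the
others leaves [T_xy >= (2 w_xy/mu_y - d_y/(2 mu_y)) |v_xy|^2]
([transport_defect_ge]).

Together with the contribution [d_x/(2 mu_x)] of [Gamma(f,f)(x)], this gives
[CD(k,2)] for each [k] below all the edge quantities
[2 w_xy/mu_y - d_y/(2 mu_y) - d_x/(2 mu_x)] ([CD_edge_bound]).  These are at
least [2 N - D] when [d/mu <= D] and [w_xy/mu_y >= N] ([CD_uniform_bound]).
The general bound takes the extremal [D] and [N]; on an unweighted cycle,
where degrees are 2, [D = 2/nu0] and [N = 1/nu0] make the curvature vanish.

The orthogonal and unitary cases are treated at once: all that matters is that
[conjs] and [ofreal] are ring morphisms, that [ofreal] is monotone with values
fixed by [conjs], and that [a * conjs a = |a|^2].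
*)

Set Implicit Arguments.
Unset Strict Implicit.
Unset Printing Implicit Defensive.

Import Order.TTheory GRing.Theory Num.Theory.
Local Open Scope ring_scope.

(** * Conjugation and real scalars, uniformly in the group *)

Section Scalars.
Variables (R : realType) (H : matrix_group).

Fact conjs_is_zmod_morphism : zmod_morphism (@conjs R H).
Proof. by case: H => // a b; apply: rmorphB. Qed.

Fact conjs_is_monoid_morphism : monoid_morphism (@conjs R H).
Proof. by case: H => //; split=> [|a b]; [apply: rmorph1 | apply: rmorphM]. Qed.

HB.instance Definition _ :=
  GRing.isZmodMorphism.Build _ _ (@conjs R H) conjs_is_zmod_morphism.
HB.instance Definition _ :=
  GRing.isMonoidMorphism.Build _ _ (@conjs R H) conjs_is_monoid_morphism.

Fact ofreal_is_zmod_morphism : zmod_morphism (@ofreal R H).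
Proof. by case: H => // a b; apply: (rmorphB (real_complex R)). Qed.

Fact ofreal_is_monoid_morphism : monoid_morphism (@ofreal R H).
Proof. by case: H => //; split=> // a b; apply: (rmorphM (real_complex R)). Qed.

HB.instance Definition _ :=
  GRing.isZmodMorphism.Build _ _ (@ofreal R H) ofreal_is_zmod_morphism.
HB.instance Definition _ :=
  GRing.isMonoidMorphism.Build _ _ (@ofreal R H) ofreal_is_monoid_morphism.

Lemma conjs_ofreal (a : R) : conjs (ofreal H a) = ofreal H a.
Proof.
case: H => //=; apply/CrealP/complex_realP; by exists a.
Qed.

Lemma mul_conjs (a : scalars R H) : a * conjs a = `|a| ^+ 2.
Proof.
case: H a => /= a; first by rewrite real_normK ?num_real // expr2.
by rewrite normCK.
Qed.

Lemma ler_ofreal (a b : R) : (ofreal H a <= ofreal H b) = (a <= b).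
Proof. by case: H => //=; rewrite lecR. Qed.

Lemma ofreal_ge0 (a : R) : 0 <= a -> 0 <= ofreal H a.
Proof. by rewrite -(rmorph0 (@ofreal R H)) ler_ofreal. Qed.

Lemma ofreal_half : ofreal H (2^-1 : R) = 2^-1.
Proof. by rewrite fmorphV rmorph_nat. Qed.

Lemma in_groupE (d : nat) (A : 'M[scalars R H]_d) :
  in_group A -> A *m (map_mx (@conjs R H) A)^T = 1%:M.
Proof.
case: H A => /= A.
  by move=> <-; congr (_ *m _^T); apply/matrixP=> i j; rewrite mxE.
by move/unitarymxP => <-; rewrite map_trmx.
Qed.

End Scalars.

(** * The invariant form on the fibres *)

Section HermitianForm.
Variables (R : realType) (H : matrix_group) (d : nat).
Local Notation K := (scalars R H).
Local Notation r := (@ofreal R H).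
Implicit Types (u v w : 'cV[K]_d) (A : 'M[K]_d).

Definition dot u v : K := (u^T *m map_mx (@conjs R H) v) 0 0.

Lemma hprodE (T : wgraph R) (f g : T -> 'cV[K]_d) x :
  hprod f g x = dot (f x) (g x).
Proof. by []. Qed.

Lemma dotDl u v w : dot (u + v) w = dot u w + dot v w.
Proof. by rewrite /dot linearD mulmxDl mxE. Qed.

Lemma dotDr u v w : dot w (u + v) = dot w u + dot w v.
Proof. by rewrite /dot map_mxD mulmxDr mxE. Qed.

Lemma dotNl u w : dot (- u) w = - dot u w.
Proof. by rewrite /dot linearN mulNmx mxE. Qed.

Lemma dotNr u w : dot w (- u) = - dot w u.
Proof. by rewrite /dot map_mxN mulmxN mxE. Qed.

Lemma dotZl (a : R) u w : dot (r a *: u) w = r a * dot u w.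
Proof. by rewrite /dot linearZ -scalemxAl mxE. Qed.

Lemma dotZr (a : R) u w : dot w (r a *: u) = r a * dot w u.
Proof. by rewrite /dot map_mxZ /= conjs_ofreal -scalemxAr mxE. Qed.

Lemma dot_suml I (s : seq I) P (F : I -> 'cV[K]_d) w :
  dot (\sum_(i <- s | P i) F i) w = \sum_(i <- s | P i) dot (F i) w.
Proof. by rewrite /dot linear_sum mulmx_suml summxE. Qed.

Lemma dot_sumr I (s : seq I) P (F : I -> 'cV[K]_d) w :
  dot w (\sum_(i <- s | P i) F i) = \sum_(i <- s | P i) dot w (F i).
Proof. by rewrite /dot raddf_sum mulmx_sumr summxE. Qed.

Lemma dot_sqnorm u : dot u u = sqnorm u.
Proof. by rewrite /dot mxE; apply: eq_bigr => i _; rewrite !mxE mul_conjs. Qed.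

Lemma dot_ge0 u : 0 <= dot u u.
Proof. by rewrite dot_sqnorm sumr_ge0 // => i _; rewrite exprn_ge0. Qed.

Lemma dot_in_group A u v : in_group A -> dot (A *m u) (A *m v) = dot u v.
Proof.
move=> /in_groupE/mulmx1C/(congr1 trmx); rewrite trmx_mul trmxK trmx1 => Au.
by rewrite /dot trmx_mul map_mxM -mulmxA (mulmxA A^T) Au mul1mx.
Qed.

End HermitianForm.

(** * Curvature of a graph with signature *)

Section Curvature.
Variables (R : realType) (H : matrix_group) (d : nat).
Variables (G : wgraph R) (mu : G -> R).
Variable sigma : G -> G -> 'M[scalars R H]_d.
Hypothesis mu_gt0 : forall x, 0 < mu x.
Hypothesis sigmaP : signature sigma.
Local Notation K := (scalars R H).
Local Notation r := (@ofreal R H).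
Implicit Types f g : G -> 'cV[K]_d.

Definition edge_diff f x y := sigma x y *m f y - f x.

Lemma slapE f x :
  slap mu sigma f x =
  r (mu x)^-1 *: \sum_(y | adj x y) r (wt x y) *: edge_diff f x y.
Proof. by []. Qed.

(** The second-order differences in the definition of [Gam] collapse to a
    product of first-order ones because [sigma x y] preserves [dot]: the term
    [dot (f y) (g y)] may be transported to the fibre at [x]. *)
Lemma GamE f g x :
  Gam mu sigma f g x =
  2^-1 * (r (mu x)^-1 * \sum_(y | adj x y)
    r (wt x y) * dot (edge_diff f x y) (edge_diff g x y)).
Proof.
rewrite /Gam /lap !hprodE !slapE dotZl dotZr dot_suml dot_sumr.
rewrite -!mulrBr -!sumrB; congr (_ * (_ * _)); apply: eq_bigr => y axy.
rewrite !hprodE dotZl dotZr -!mulrBr; congr (_ * _).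
have [sxy _] := sigmaP axy.
rewrite -(dot_in_group _ _ sxy) /edge_diff !(dotDl, dotDr, dotNl, dotNr).
by ring.
Qed.

(** Holonomy is trivial along a backtracking walk, so walking an edge back
    reverses the derivative. *)
Lemma edge_diff_back f x y : adj x y ->
  sigma x y *m edge_diff f y x = - edge_diff f x y.
Proof.
move=> axy; have [sxy syx] := sigmaP axy.
have [sxy_unit _] := mulmx1_unit (in_groupE sxy).
by rewrite mulmxBr mulmxA syx mulmxV // mul1mx opprB.
Qed.

(** The part of the Bochner formula that lives on the edge [xy] and looks one
    step beyond it; the half-sum of the two products is the real part of
    [dot (edge_diff f x y) (sigma x y *m slap mu sigma f y)]. *)
Definition transport_defect f x y : K :=
  Gam mu sigma f f y
  - 2^-1 * (dot (edge_diff f x y) (sigma x y *m slap mu sigma f y)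
            + dot (sigma x y *m slap mu sigma f y) (edge_diff f x y)).

(** Transported to the fibre at [x], both parts of the defect become averages
    over the neighbours [z] of [y]; completing the square in each summand,
    with [a = sigma x y *m edge_diff f y z], uses
    [|a|^2 - <v,a> - <a,v> = |a - v|^2 - |v|^2]. *)
Lemma transport_defectE f x y : adj x y ->
  let v := edge_diff f x y in
  transport_defect f x y =
  2^-1 * (r (mu y)^-1 * \sum_(z | adj y z) r (wt y z) *
    (dot (sigma x y *m edge_diff f y z - v) (sigma x y *m edge_diff f y z - v)
     - dot v v)).
Proof.
move=> axy v; have [sxy _] := sigmaP axy.
rewrite /transport_defect GamE slapE -scalemxAr mulmx_sumr dotZl dotZr.
rewrite -mulrDr -mulrBr dot_suml dot_sumr -big_split /= -mulrBr -sumrB.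
congr (_ * (_ * _)); apply: eq_bigr => z ayz.
rewrite -scalemxAr dotZl dotZr -mulrDr -mulrBr; congr (_ * _).
rewrite -(dot_in_group _ _ sxy) -/v !(dotDl, dotDr, dotNl, dotNr).
by ring.
Qed.

(** Only the square indexed by [z = x] is kept; there the vectors are opposite,
    so that the square is [4 * dot v v]. *)
Lemma transport_defect_ge f x y : adj x y ->
  r (2 * (wt x y / mu y) - 2^-1 * (wdeg y / mu y))
    * dot (edge_diff f x y) (edge_diff f x y) <= transport_defect f x y.
Proof.
move=> axy; rewrite transport_defectE //.
set v := edge_diff f x y.
have ayx : adj y x by rewrite adj_sym.
under eq_bigr do rewrite mulrBr.
rewrite sumrB -mulr_suml -(rmorph_sum r) -/(wdeg y).
have r_ge0 := @ofreal_ge0 R H.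
have star : 4 * (r (wt y x) * dot v v) <= \sum_(z | adj y z) r (wt y z) *
    dot (sigma x y *m edge_diff f y z - v) (sigma x y *m edge_diff f y z - v).
  rewrite (bigD1 x) //= edge_diff_back // -/v.
  have -> : dot (- v - v) (- v - v) = 4 * dot v v.
    by rewrite !(dotDl, dotDr, dotNl, dotNr); ring.
  rewrite mulrCA lerDl sumr_ge0 // => z /andP[ayz _].
  by rewrite mulr_ge0 ?dot_ge0 // r_ge0 // ltW // wt_gt0.
have mu_ge0 : 0 <= r (mu y)^-1 by rewrite r_ge0 // invr_ge0 ltW.
apply: le_trans (_ : 2^-1 * (r (mu y)^-1 *
   (4 * (r (wt y x) * dot v v) - r (wdeg y) * dot v v)) <= _).
  rewrite (wt_sym axy) rmorphB !rmorphM /= ofreal_half rmorph_nat.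
  have alg (F : numFieldType) (a b c e : F) :
      (2 * (a * c) - 2^-1 * (b * c)) * e = 2^-1 * (c * (4 * (a * e) - b * e)).
    by field.
  by rewrite alg.
by rewrite ler_wpM2l ?invr_ge0 // ler_wpM2l // lerB.
Qed.

(** Bochner formula.  The weighted sum of the edge derivatives at [x] is
    [mu x] times the Laplacian, so the products of these derivatives with the
    Laplacian at [x] itself add up to its squared norm. *)
Lemma Gam2E f x :
  Gam2 mu sigma f f x =
  2^-1 * (r (mu x)^-1 * \sum_(y | adj x y)
            r (wt x y) * (transport_defect f x y - Gam mu sigma f f x)
          + sqnorm (slap mu sigma f x)).
Proof.
rewrite /Gam2 (GamE f (slap _ _ _)) (GamE (slap _ _ _) f) /lap.
set L := slap mu sigma f x.
have -> : sqnorm L = 2^-1 * (r (mu x)^-1 * \sum_(y | adj x y)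
    r (wt x y) * (dot (edge_diff f x y) L + dot L (edge_diff f x y))).
  under eq_bigr do rewrite mulrDr -dotZl -dotZr.
  rewrite big_split /= -dot_suml -dot_sumr mulrDr -dotZl -dotZr.
  by rewrite -!slapE -/L -dot_sqnorm; field.
rewrite !(mulrCA 2^-1) -!mulrBr -mulrDr !mulr_sumr -!sumrB -big_split /=.
congr (_ * (_ * _)); apply: eq_bigr => y _.
rewrite /transport_defect [edge_diff (slap _ _ _) x y]/edge_diff -/L.
rewrite !(dotDl, dotDr, dotNl, dotNr).
by ring.
Qed.

(** Averaging [transport_defect_ge] over the edges at [x] reproduces [Gam] at
    [x], since both are weighted sums of the same squares; the subtracted
    [Gam] of the Bochner formula, counted [wdeg x] times, costs the last
    term. *)
Lemma CD_edge_bound (k : R) :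
  (forall x y, adj x y ->
    k <= 2 * (wt x y / mu y) - 2^-1 * (wdeg y / mu y)
         - 2^-1 * (wdeg x / mu x)) ->
  CD mu sigma k 2.
Proof.
move=> kP f x; rewrite Gam2E mulrDr addrC.
have -> : r (1 / 2) = 2^-1 by rewrite div1r ofreal_half.
rewrite lerD2r.
have r_ge0 := @ofreal_ge0 R H.
have mu_ge0 : 0 <= r (mu x)^-1 by rewrite r_ge0 // invr_ge0 ltW.
rewrite GamE mulrCA ler_wpM2l ?invr_ge0 // mulrCA ler_wpM2l //.
set S := \sum_(y | _) _.
under eq_bigr do rewrite mulrBr.
rewrite sumrB -mulr_suml -(rmorph_sum r) -/(wdeg x).
rewrite lerBrDr.
have -> : r (wdeg x) * (2^-1 * (r (mu x)^-1 * S))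
    = r (2^-1 * (wdeg x / mu x)) * S.
  by rewrite !rmorphM /= ofreal_half; ring.
rewrite -mulrDl -rmorphD mulr_sumr; apply: ler_sum => y axy.
rewrite mulrCA ler_wpM2l ?r_ge0 ?(ltW (wt_gt0 axy)) //.
apply: le_trans (transport_defect_ge f axy).
by rewrite ler_wpM2r ?dot_ge0 // ler_ofreal -lerBrDr kP.
Qed.

Lemma CD_uniform_bound (D N : R) :
  (forall x, wdeg x / mu x <= D) ->
  (forall x y, adj x y -> N <= wt x y / mu y) ->
  CD mu sigma (2 * N - D) 2.
Proof.
move=> degP wtP; apply: CD_edge_bound => x y axy.
have lin (F : realFieldType) (a b c D' N' : F) : a <= D' -> b <= D' -> N' <= c ->
    2 * N' - D' <= 2 * c - 2^-1 * b - 2^-1 * a by lra.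
exact: lin (degP x) (degP y) (wtP x y axy).
Qed.

End Curvature.

(** * Cycles and the curvature bounds *)

(** The neighbours of [x] lie among its successor and its predecessor in the
    cyclic enumeration. *)
Lemma wdeg_cycle_le2 (R : realType) (G : wgraph R) (x : G) :
  unweighted G -> cycle_graph G -> wdeg x <= 2.
Proof.
move=> w1 [s [us _ _ adjE]].
rewrite /wdeg (eq_bigr (fun=> 1)) => [|y /w1 //].
rewrite sumr_const -[leRHS]/(2%:R) ler_nat.
apply: leq_trans (_ : (#|pred2 (next s x) (prev s x)| <= 2)%N).
  apply/subset_leq_card/subsetP => y; rewrite !inE => axy.
  have {axy} : adj x y := axy; rewrite adjE.
  by case/orP => /eqP->; rewrite ?eqxx // prev_next // eqxx orbT.
by rewrite card2; case: (_ != _).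
Qed.

Theorem corollary3p8 (R : realType) (H : matrix_group) (d : nat) :
  (forall (G : wgraph R) (mu : G -> R) (sigma : G -> G -> 'M[scalars R H]_d),
      (exists x y : G, adj x y) ->
      (forall x : G, 0 < mu x) ->
      signature sigma ->
      CD mu sigma (2 / Dnor mu - Dnon mu) 2)
  /\
  (forall (G : wgraph R) (nu0 : R) (sigma : G -> G -> 'M[scalars R H]_d),
      unweighted G ->
      cycle_graph G ->
      0 < nu0 ->
      signature sigma ->
      CD (fun _ : G => nu0) sigma 0 2).
Proof.
split=> [G mu sigma _ mu_gt0 sigmaP | G nu0 sigma w1 cG nu0_gt0 sigmaP].
  apply: CD_uniform_bound => // [x | x y axy]; first exact: le_bigmax.
  have ayx : adj y x by rewrite adj_sym.
  have nor : mu y / wt y x <= Dnor mu.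
    apply: le_trans (le_bigmax _ _ y).
    exact: (le_bigmax_cond _ (fun z => mu y / wt y z)).
  have q_gt0 : 0 < mu y / wt y x by rewrite divr_gt0 ?wt_gt0.
  by rewrite (wt_sym axy) -invf_div lef_pV2 // posrE (lt_le_trans q_gt0).
(* [0] is read as [2 * N - D] with [N = nu0^-1] and [D = 2 / nu0]. *)
rewrite -(subrr (2 / nu0)); apply: CD_uniform_bound => // [x | x y axy].
  by rewrite ler_pM2r ?invr_gt0 // wdeg_cycle_le2.
by rewrite (w1 _ _ axy) div1r.
Qed.
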